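(* For $p\in(0,1]$ consider the initial value problem $$\varphi_1''=(1-2\varphi_1^2-8\varphi_2^2)\varphi_1,\qquad \varphi_2''=(4-2\varphi_1^2-8\varphi_2^2)\varphi_2,$$ $$\varphi_1(0)=0,\quad \varphi_2(0)=p,\quad \varphi_1'(0)=2p,\quad \varphi_2'(0)=0,$$ for real functions $\varphi_1,\varphi_2$ on $\mathbb{R}$. Among all the solutions obtained as $p$ ranges over $(0,1]$, there exists only one which is periodic and satisfies both of the following conditions: $\varphi_1$ has exactly two zeros in a period, and $\varphi_2$ is positive everywhere. It corresponds to the initial value $\varphi_2(0)=p=\sqrt{3/8}$.
   Context: A solution is called periodic if the pair $(\varphi_1,\varphi_2)$ is periodic; its period is the (least) period $T$ of the pair $(\varphi_1,\varphi_2)$, and zeros ''in a period'' are counted in a half-open interval of length $T$, e.g. $[0,T)$. *)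

(* Defs.v *)
From Stdlib Require Import Reals.
From Coquelicot Require Import Coquelicot.
Open Scope R_scope.

(* [is_derive_n f 2 t l] says that the total function [Derive f] has derivative
   [l] at [t]; [ex_derive] is needed so that [Derive f] is the genuine [f']. *)
Definition is_solution (p : R) (phi1 phi2 : R -> R) : Prop :=
  (forall t : R, ex_derive phi1 t /\ ex_derive phi2 t) /\
  (forall t : R,
     is_derive_n phi1 2 t ((1 - 2 * phi1 t ^ 2 - 8 * phi2 t ^ 2) * phi1 t)) /\
  (forall t : R,
     is_derive_n phi2 2 t ((4 - 2 * phi1 t ^ 2 - 8 * phi2 t ^ 2) * phi2 t)) /\
  phi1 0 = 0 /\ phi2 0 = p /\ Derive phi1 0 = 2 * p /\ Derive phi2 0 = 0.

Definition is_period (phi1 phi2 : R -> R) (T : R) : Prop :=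
  0 < T /\ forall t : R, phi1 (t + T) = phi1 t /\ phi2 (t + T) = phi2 t.

Definition is_least_period (phi1 phi2 : R -> R) (T : R) : Prop :=
  is_period phi1 phi2 T /\
  forall S : R, is_period phi1 phi2 S -> T <= S.

Definition two_zeros_on (f : R -> R) (T : R) : Prop :=
  exists a b : R, a <> b /\
    forall t : R, (0 <= t < T /\ f t = 0) <-> (t = a \/ t = b).

Definition admissible (phi1 phi2 : R -> R) : Prop :=
  (exists T : R, is_least_period phi1 phi2 T /\ two_zeros_on phi1 T) /\
  (forall t : R, 0 < phi2 t).

(* Main.v *)
Require Import Defs.
From Stdlib Require Import Reals.
From Stdlib Require Import Lra.
From Coquelicot Require Import Coquelicot.
Open Scope R_scope.

(** Put [u = phi1], [v = 2 phi2] and [r2 = u^2 + v^2].  The system becomes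
    [u'' = (1 - 2 r2) u], [v'' = (4 - 2 r2) v], a completely integrable system
    with two quartic first integrals ([energy] and [integral_u]); the solution
    in question starts at [u = 0], [v = u' = 2p], [v' = 0].

    Large [p].  If [3/4 <= p^2], the two integrals force [r2 > 2] at each
    critical point of [v] with [v > 0], hence [v'' < 0] there: all critical
    points are maxima, and a periodic [v] cannot stay positive
    ([positive_flow_not_periodic]).

    Small [p].  If [p^2 < 3/4], the system separates in the elliptic coordinates
    [l1 <= 1 < l2 < 4] given by [u^2 = (1 - l1)(l2 - 1)/3] and
    [v^2 = (4 - l1)(4 - l2)/3].  With [d = 3/2 - 4 p^2], the coordinate [l1]
    oscillates in [[0,1]] and [l2] between [5/2 - d] and [5/2 + d], so they are
    written [l1 = cos^2 th] and [l2 = 5/2 + d cos ph] with angles that increase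
    for ever.  The solution is obtained explicitly by quadratures:
    [d th * weight1 = d ph * weight2] gives [ph] as a function of [th], and a
    further quadrature gives the time ([angles_exist], [angles_flow]); it is the
    only solution, by Gronwall's lemma ([flow_unique]).  Here [v] never vanishes,
    and [u] vanishes exactly when [sin th = 0], so having two zeros in a period
    [T] means [th T = 2 pi] ([two_zeros_angle]).  Then [v T = v 0] forces
    [d cos (ph T) = d], so [d = 0] or [ph T] is a multiple of [2 pi].

    The heart of the proof is that the second alternative never occurs: while
    [th] makes one turn, [ph] makes strictly more than one turn and strictly less
    than two ([periods_interlace]).  These are inequalities between hyperelliptic
    periods; all of them are compared with the single complete elliptic integral
    of [weightK], with rational constants that leave enough room.

    So [d = 0], that is [p^2 = 3/8].  In that case [l2 = 5/2] is constant, the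
    orbit lies on the hyperbola [v^2 = u^2 + 3/2], the motion is periodic, and
    the conditions are satisfied ([hyperbolic_orbit_admissible]). *)

(** * Calculus on the real line *)

Lemma is_derive_continuity (f g : R -> R) :
  (forall x, is_derive f x (g x)) -> continuity f.
Proof.
  intros Hf x. apply continuity_pt_filterlim.
  apply (ex_derive_continuous (K := R_AbsRing) (V := R_NormedModule)).
  now exists (g x).
Qed.

Lemma mean_value (f g : R -> R) (a b : R) :
  (forall x, is_derive f x (g x)) ->
  exists c, Rmin a b <= c <= Rmax a b /\ f b - f a = g c * (b - a).
Proof.
  intros Hf. apply MVT_gen; intros x _; [apply Hf|].
  exact (is_derive_continuity f g Hf x).
Qed.

Lemma derive_nonneg_incr (f g : R -> R) (a b : R) :
  (forall x, is_derive f x (g x)) -> (forall x, 0 <= g x) -> a <= b ->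
  f a <= f b.
Proof.
  intros Hf Hg Hab. destruct (mean_value f g a b Hf) as [c [_ Hc]].
  specialize (Hg c). nra.
Qed.

Lemma derive_pos_incr (f g : R -> R) (a b : R) :
  (forall x, is_derive f x (g x)) -> (forall x, 0 < g x) -> a < b ->
  f a < f b.
Proof.
  intros Hf Hg Hab. destruct (mean_value f g a b Hf) as [c [_ Hc]].
  specialize (Hg c). nra.
Qed.

Lemma derive_zero_const (f : R -> R) (a b : R) :
  (forall x, is_derive f x 0) -> f a = f b.
Proof.
  intros Hf. destruct (mean_value f (fun _ => 0) a b Hf) as [c [_ Hc]]. lra.
Qed.

Lemma exists_antiderivative (w : R -> R) :
  (forall x, ex_derive w x) ->
  exists F : R -> R, F 0 = 0 /\ forall x, is_derive F x (w x).
Proof.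
  intros Hw.
  assert (Hc : forall x, continuous w x).
  { intros x. now apply (ex_derive_continuous (K := R_AbsRing) (V := R_NormedModule)). }
  exists (fun x => RInt w 0 x). split; [exact (RInt_point 0 w)|].
  intros x. apply (is_derive_RInt w (fun y => RInt w 0 y) 0); [|apply Hc].
  exists (mkposreal 1 Rlt_0_1). intros y _. apply (RInt_correct w).
  apply (ex_RInt_continuous w). intros z _. apply Hc.
Qed.

(** The lower bound on the derivative makes [f] onto and its inverse Lipschitz;
    this is how the quadratures below are inverted. *)
Lemma differentiable_inverse (f g : R -> R) (m : R) :
  0 < m -> (forall x, is_derive f x (g x)) -> (forall x, m <= g x) ->
  exists k : R -> R,
    (forall y, f (k y) = y) /\ (forall x, k (f x) = x) /\
    (forall y, is_derive k y (/ g (k y))).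
Proof.
  intros Hm Hf Hg.
  assert (Hpos : forall x, 0 < g x) by (intro x; specialize (Hg x); lra).
  assert (Hlip : forall a b, a <= b -> m * (b - a) <= f b - f a).
  { intros a b Hab. destruct (mean_value f g a b Hf) as [c [_ Hc]].
    specialize (Hg c). nra. }
  assert (Hinj : forall a b, f a = f b -> a = b).
  { intros a b E. destruct (Rtotal_order a b) as [H|[H|H]]; trivial;
      apply (derive_pos_incr f g) in H; trivial; lra. }
  assert (Hsur : forall y, {x | f x = y}).
  { intros y. set (r := Rabs (y - f 0) / m).
    assert (Hr : m * r = Rabs (y - f 0)) by (unfold r; field; lra).
    assert (Hr0 : 0 <= r).
    { unfold r. apply Rmult_le_pos; [apply Rabs_pos|].
      left. now apply Rinv_0_lt_compat. }
    destruct (IVT_gen f (- r) r y) as [x [_ Hx]].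
    - exact (is_derive_continuity f g Hf).
    - generalize (Hlip (- r) 0) (Hlip 0 r) (Rle_abs (y - f 0))
        (Rle_abs (- (y - f 0))). rewrite Rabs_Ropp.
      intros H1 H2 H3 H4. specialize (H1 ltac:(lra)). specialize (H2 ltac:(lra)).
      rewrite Rmin_left, Rmax_right by lra. lra.
    - now exists x. }
  assert (Hk : exists k : R -> R, forall y, f (k y) = y).
  { exists (fun y => proj1_sig (Hsur y)). intros y. exact (proj2_sig (Hsur y)). }
  destruct Hk as [k Hfk].
  assert (Hkf : forall x, k (f x) = x) by (intro x; apply Hinj, Hfk).
  exists k.
  split; [exact Hfk|split; [exact Hkf|]].
  assert (Hki : forall a b, a <= b -> k a <= k b).
  { intros a b Hab. destruct (Rle_or_lt (k a) (k b)) as [H|H]; trivial.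
    apply (derive_pos_incr f g) in H; trivial. rewrite !Hfk in H. lra. }
  intros y.
  assert (Hkc : continuity_pt k y).
  { apply continuity_pt_filterlim.
    apply filterlim_locally. intros eps.
    assert (He : 0 < m * eps) by (apply Rmult_lt_0_compat; [lra|apply cond_pos]).
    exists (mkposreal _ He). intros z Hz.
    change (Rabs (z - y) < m * eps) in Hz.
    change (Rabs (k z - k y) < eps).
    apply Rabs_def2 in Hz. apply Rabs_def1.
    - destruct (Rle_or_lt (k y) (k z)) as [H|H].
      + apply Hlip in H. rewrite !Hfk in H. nra.
      + destruct eps as [e Hpe]; simpl in *; lra.
    - destruct (Rle_or_lt (k z) (k y)) as [H|H].
      + apply Hlip in H. rewrite !Hfk in H. nra.
      + destruct eps as [e Hpe]; simpl in *; lra. }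
  apply is_derive_Reals.
  assert (Prf : forall a, k (y - 1) <= a <= k (y + 1) -> derivable_pt f a).
  { intros a _. exists (g a). now apply is_derive_Reals. }
  assert (Hky : k (y - 1) <= k y <= k (y + 1)) by (split; apply Hki; lra).
  assert (E : derive_pt f (k y) (Prf (k y) Hky) = g (k y)).
  { apply derive_pt_eq_0. now apply is_derive_Reals. }
  replace (/ g (k y)) with (1 / derive_pt f (k y) (Prf (k y) Hky)).
  - apply Ranalysis5.derivable_pt_lim_recip_interv; try lra; trivial.
    + intros x0 _. apply Hfk.
    + rewrite E. specialize (Hpos (k y)). lra.
  - rewrite E. unfold Rdiv. ring.
Qed.

(** * The first-order system, its integrals, and uniqueness *)

(** The velocities [u1], [v1] are kept as separate functions, so that the two
    first integrals are polynomials in the four unknowns. *)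
Definition is_flow (u v u1 v1 : R -> R) : Prop :=
  forall t,
    is_derive u t (u1 t) /\ is_derive v t (v1 t) /\
    is_derive u1 t ((1 - 2 * (u t ^ 2 + v t ^ 2)) * u t) /\
    is_derive v1 t ((4 - 2 * (u t ^ 2 + v t ^ 2)) * v t).

Definition starts_at (p : R) (u v u1 v1 : R -> R) : Prop :=
  u 0 = 0 /\ v 0 = 2 * p /\ u1 0 = 2 * p /\ v1 0 = 0.

Lemma solution_flow (p : R) (phi1 phi2 : R -> R) :
  is_solution p phi1 phi2 ->
  is_flow phi1 (fun t => 2 * phi2 t) (Derive phi1) (fun t => 2 * Derive phi2 t) /\
  starts_at p phi1 (fun t => 2 * phi2 t) (Derive phi1)
    (fun t => 2 * Derive phi2 t).
Proof.
  intros (Hex & H1 & H2 & E1 & E2 & E3 & E4). split.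
  - intros t. destruct (Hex t) as [Hex1 Hex2]. split; [|split; [|split]].
    + now apply Derive_correct.
    + apply (is_derive_scal phi2 t 2 (Derive phi2 t)). now apply Derive_correct.
    + replace ((1 - 2 * (phi1 t ^ 2 + (2 * phi2 t) ^ 2)) * phi1 t)
        with ((1 - 2 * phi1 t ^ 2 - 8 * phi2 t ^ 2) * phi1 t) by ring.
      exact (H1 t).
    + replace ((4 - 2 * (phi1 t ^ 2 + (2 * phi2 t) ^ 2)) * (2 * phi2 t))
        with (2 * ((4 - 2 * phi1 t ^ 2 - 8 * phi2 t ^ 2) * phi2 t)) by ring.
      apply (is_derive_scal (Derive phi2) t 2). exact (H2 t).
  - repeat split; lra.
Qed.

Lemma flow_solution (p : R) (u v u1 v1 : R -> R) :
  is_flow u v u1 v1 -> starts_at p u v u1 v1 ->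
  is_solution p u (fun t => v t / 2).
Proof.
  intros Hf (E1 & E2 & E3 & E4).
  assert (Hv : forall t, is_derive (fun t => v t / 2) t (v1 t / 2)).
  { intros t. destruct (Hf t) as (_ & H & _).
    replace (v1 t / 2) with (/ 2 * v1 t) by field.
    apply (is_derive_ext (fun t => / 2 * v t)).
    - intros s. apply Rmult_comm.
    - now apply is_derive_scal. }
  split; [|split; [|split; [|repeat split]]].
  - intros t. split; [exists (u1 t); apply Hf | exists (v1 t / 2); apply Hv].
  - intros t. apply (is_derive_ext u1).
    + intros s. symmetry. apply is_derive_unique, Hf.
    + replace ((1 - 2 * u t ^ 2 - 8 * (v t / 2) ^ 2) * u t)
        with ((1 - 2 * (u t ^ 2 + v t ^ 2)) * u t) by field.
      apply Hf.
  - intros t. apply (is_derive_ext (fun s => / 2 * v1 s)).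
    + intros s. transitivity (v1 s / 2); [apply Rmult_comm|].
      symmetry. exact (is_derive_unique _ _ _ (Hv s)).
    + replace ((4 - 2 * u t ^ 2 - 8 * (v t / 2) ^ 2) * (v t / 2))
        with (/ 2 * ((4 - 2 * (u t ^ 2 + v t ^ 2)) * v t)) by field.
      apply is_derive_scal. apply Hf.
  - exact E1.
  - rewrite E2. field.
  - rewrite (is_derive_unique u 0 (u1 0)); [exact E3|apply Hf].
  - transitivity (v1 0 / 2); [exact (is_derive_unique _ _ _ (Hv 0))|].
    rewrite E4. field.
Qed.

(** [compute_derive] proves an [is_derive] goal up to an algebraic identity:
    unknown functions inside the expression are handled by the [is_derive]
    facts present in the context. *)
Ltac rewrite_derive :=
  repeat match goal with
  | H : is_derive _ ?t ?l |- context [Derive ?g ?t] =>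
      replace (Derive g t) with l by (symmetry; exact (is_derive_unique _ _ _ H))
  end.

Ltac compute_derive :=
  auto_derive; [repeat split; trivial; eexists; eassumption |]; rewrite_derive.

Ltac flow_derive Hf t :=
  let A := fresh in let B := fresh in let C := fresh in let D := fresh in
  destruct (Hf t) as (A & B & C & D); compute_derive.

Definition energy (u v u1 v1 : R) : R :=
  (u1 ^ 2 + v1 ^ 2) / 2 - u ^ 2 / 2 - 2 * v ^ 2 + (u ^ 2 + v ^ 2) ^ 2 / 2.

(** The first integral attached to the coefficient [1] of the system; the divisor
    [3] is the difference of the two coefficients [4] and [1]. *)
Definition integral_u (u v u1 v1 : R) : R :=
  u1 ^ 2 - u ^ 2 + u ^ 2 * (u ^ 2 + v ^ 2) - (u * v1 - v * u1) ^ 2 / 3.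

Lemma energy_conserved (u v u1 v1 : R -> R) :
  is_flow u v u1 v1 ->
  forall t, energy (u t) (v t) (u1 t) (v1 t) = energy (u 0) (v 0) (u1 0) (v1 0).
Proof.
  intros Hf t.
  apply (derive_zero_const (fun t => energy (u t) (v t) (u1 t) (v1 t))).
  intros s. unfold energy. flow_derive Hf s. field.
Qed.

Lemma integral_u_conserved (u v u1 v1 : R -> R) :
  is_flow u v u1 v1 ->
  forall t, integral_u (u t) (v t) (u1 t) (v1 t)
            = integral_u (u 0) (v 0) (u1 0) (v1 0).
Proof.
  intros Hf t.
  apply (derive_zero_const (fun t => integral_u (u t) (v t) (u1 t) (v1 t))).
  intros s. unfold integral_u. flow_derive Hf s. field.
Qed.

(** [D exp(-L t)] decreases and [D exp(L t)] increases, so [D] vanishes on both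
    sides of [0]. *)
Lemma gronwall_zero (D D1 : R -> R) (L : R) :
  (forall t, is_derive D t (D1 t)) -> (forall t, 0 <= D t) ->
  (forall t, - (L * D t) <= D1 t <= L * D t) -> D 0 = 0 ->
  forall t, D t = 0.
Proof.
  intros HD Hpos Hb H0 t.
  assert (He : exists e, 0 < e /\ D t * e <= 0).
  { destruct (Rle_or_lt 0 t) as [Ht|Ht].
    - exists (exp (- L * t)). split; [apply exp_pos|].
      enough (- (D 0 * exp (- L * 0)) <= - (D t * exp (- L * t)))
        by (rewrite H0 in *; lra).
      apply (derive_nonneg_incr (fun s => - (D s * exp (- L * s)))
        (fun s => (L * D s - D1 s) * exp (- L * s))); trivial.
      + intros s. auto_derive; [repeat split; eexists; apply HD|].
        change (Derive (fun x => D x) s) with (Derive D s).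
        rewrite (is_derive_unique _ _ _ (HD s)). ring.
      + intros s. apply Rmult_le_pos; [specialize (Hb s); lra|].
        left; apply exp_pos.
    - exists (exp (L * t)). split; [apply exp_pos|].
      enough (D t * exp (L * t) <= D 0 * exp (L * 0))
        by (rewrite H0 in *; lra).
      apply (derive_nonneg_incr (fun s => D s * exp (L * s))
        (fun s => (L * D s + D1 s) * exp (L * s))); [| |lra].
      + intros s. auto_derive; [repeat split; eexists; apply HD|].
        change (Derive (fun x => D x) s) with (Derive D s).
        rewrite (is_derive_unique _ _ _ (HD s)). ring.
      + intros s. apply Rmult_le_pos; [specialize (Hb s); lra|].
        left; apply exp_pos. }
  destruct He as (e & He & Hle). specialize (Hpos t). nra.
Qed.

Lemma cross_term_bound (c C x y : R) :
  - C <= c <= C -> - (C * (x ^ 2 + y ^ 2)) <= 2 * (c * x * y) <= C * (x ^ 2 + y ^ 2).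
Proof.
  intros H. generalize (pow2_ge_0 (x - y)) (pow2_ge_0 (x + y)). nra.
Qed.

(** The quartic term dominates the energy, which confines all orbits of a given
    energy to a disc; this is what makes the Lipschitz constant in the uniqueness
    proof global. *)
Lemma energy_bound (u v u1 v1 : R) :
  u ^ 2 + v ^ 2 <= 4 + 2 * Rabs (energy u v u1 v1).
Proof.
  set (e := energy u v u1 v1).
  assert (He : (u ^ 2 + v ^ 2) ^ 2 <= 2 * e + 4 * (u ^ 2 + v ^ 2))
    by (unfold e, energy; nra).
  generalize (Rle_abs e) (Rabs_pos e). intros H1 H2.
  destruct (Rle_or_lt (u ^ 2 + v ^ 2) (4 + 2 * Rabs e)) as [H|H]; trivial.
  set (r := u ^ 2 + v ^ 2) in *. set (a := Rabs e) in *. nra.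
Qed.

(** Gronwall's lemma for the squared distance of the two phase curves. *)
Lemma flow_unique (u v u1 v1 x y x1 y1 : R -> R) :
  is_flow u v u1 v1 -> is_flow x y x1 y1 ->
  u 0 = x 0 -> v 0 = y 0 -> u1 0 = x1 0 -> v1 0 = y1 0 ->
  forall t, u t = x t /\ v t = y t.
Proof.
  intros Hf Hg E1 E2 E3 E4.
  set (M := 4 + 2 * Rabs (energy (u 0) (v 0) (u1 0) (v1 0))).
  assert (Mu : forall t, u t ^ 2 + v t ^ 2 <= M).
  { intros t. unfold M. rewrite <- (energy_conserved _ _ _ _ Hf t).
    apply energy_bound. }
  assert (Mx : forall t, x t ^ 2 + y t ^ 2 <= M).
  { intros t. unfold M. rewrite E1, E2, E3, E4.
    rewrite <- (energy_conserved _ _ _ _ Hg t). apply energy_bound. }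
  set (D := fun t => (u t - x t) ^ 2 + (v t - y t) ^ 2
                     + (u1 t - x1 t) ^ 2 + (v1 t - y1 t) ^ 2).
  set (ru := fun t => u t ^ 2 + v t ^ 2).
  (* The derivative of [D], written as six products [2 c x y] of coordinate
     differences [x], [y] with a bounded coefficient [c]. *)
  set (D1 := fun t =>
    2 * (1 * (u t - x t) * (u1 t - x1 t)) + 2 * (1 * (v t - y t) * (v1 t - y1 t))
    + 2 * ((1 - 2 * ru t - 2 * x t * (u t + x t)) * (u t - x t) * (u1 t - x1 t))
    + 2 * ((- 2 * x t * (v t + y t)) * (v t - y t) * (u1 t - x1 t))
    + 2 * ((4 - 2 * ru t - 2 * y t * (v t + y t)) * (v t - y t) * (v1 t - y1 t))
    + 2 * ((- 2 * y t * (u t + x t)) * (u t - x t) * (v1 t - y1 t))).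
  assert (HD : forall t, D t = 0).
  { apply (gronwall_zero D D1 (5 + 10 * M)).
    - intros t. unfold D, D1, ru.
      destruct (Hf t) as (A1 & A2 & A3 & A4). destruct (Hg t) as (B1 & B2 & B3 & B4).
      compute_derive. ring.
    - intros t. unfold D.
      generalize (pow2_ge_0 (u t - x t)) (pow2_ge_0 (v t - y t))
        (pow2_ge_0 (u1 t - x1 t)) (pow2_ge_0 (v1 t - y1 t)). lra.
    - intros t. specialize (Mu t). specialize (Mx t). unfold D, D1, ru.
      clearbody M.
      generalize (u t) (v t) (u1 t) (v1 t) (x t) (y t) (x1 t) (y1 t) Mu Mx.
      clear. intros a b a1 b1 c d c1 d1 H1 H2.
      assert (K1 : - (1 + 6 * M) <= 1 - 2 * (a ^ 2 + b ^ 2) - 2 * c * (a + c) <= 1 + 6 * M)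
        by (generalize (pow2_ge_0 a) (pow2_ge_0 b) (pow2_ge_0 c) (pow2_ge_0 d)
              (pow2_ge_0 (a + c)) (pow2_ge_0 (a - c)); split; nra).
      assert (K2 : - (4 * M) <= - 2 * c * (b + d) <= 4 * M)
        by (generalize (pow2_ge_0 a) (pow2_ge_0 b) (pow2_ge_0 c) (pow2_ge_0 d)
              (pow2_ge_0 (b + c)) (pow2_ge_0 (b - c)) (pow2_ge_0 (d + c)) (pow2_ge_0 (d - c)); split; nra).
      assert (K3 : - (4 + 6 * M) <= 4 - 2 * (a ^ 2 + b ^ 2) - 2 * d * (b + d) <= 4 + 6 * M)
        by (generalize (pow2_ge_0 a) (pow2_ge_0 b) (pow2_ge_0 c) (pow2_ge_0 d)
              (pow2_ge_0 (b + d)) (pow2_ge_0 (b - d)); split; nra).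
      assert (K4 : - (4 * M) <= - 2 * d * (a + c) <= 4 * M)
        by (generalize (pow2_ge_0 a) (pow2_ge_0 b) (pow2_ge_0 c) (pow2_ge_0 d)
              (pow2_ge_0 (a + d)) (pow2_ge_0 (a - d)) (pow2_ge_0 (d + c)) (pow2_ge_0 (d - c)); split; nra).
      generalize (cross_term_bound 1 1 (a - c) (a1 - c1) ltac:(lra))
        (cross_term_bound 1 1 (b - d) (b1 - d1) ltac:(lra))
        (cross_term_bound _ _ (a - c) (a1 - c1) K1)
        (cross_term_bound _ _ (b - d) (a1 - c1) K2)
        (cross_term_bound _ _ (b - d) (b1 - d1) K3)
        (cross_term_bound _ _ (a - c) (b1 - d1) K4).
      generalize (pow2_ge_0 (a - c)) (pow2_ge_0 (b - d))
        (pow2_ge_0 (a1 - c1)) (pow2_ge_0 (b1 - d1)).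
      intros. split; lra.
    - unfold D. rewrite E1, E2, E3, E4. ring. }
  intros t. specialize (HD t). unfold D in HD.
  generalize (pow2_ge_0 (u t - x t)) (pow2_ge_0 (v t - y t))
    (pow2_ge_0 (u1 t - x1 t)) (pow2_ge_0 (v1 t - y1 t)). intros.
  split; apply Rminus_diag_uniq, Rsqr_0_uniq; unfold Rsqr; nra.
Qed.

(** * The two angles and their period integrals *)

(** With [l1 = cos^2 th] and [l2 = 5/2 + d cos ph] these are the square roots of
    [4 - l1], [(5/2 - d - l1)(5/2 + d - l1)], [l2], [l2 - 1] and [4 - l2]: the
    factors of the hyperelliptic polynomial that are not absorbed by the
    trigonometric parametrisations. *)
Definition root_h (th : R) : R := sqrt (4 - cos th ^ 2).
Definition root_rho (d th : R) : R := sqrt ((5 / 2 - cos th ^ 2) ^ 2 - d ^ 2).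
Definition root_l (d ph : R) : R := sqrt (5 / 2 + d * cos ph).
Definition root_g (d ph : R) : R := sqrt (3 / 2 + d * cos ph).
Definition root_k (d ph : R) : R := sqrt (3 / 2 - d * cos ph).

Lemma cos_sq_bounds (x : R) : 0 <= cos x ^ 2 <= 1.
Proof. generalize (COS_bound x). nra. Qed.

Lemma sin_sq (x : R) : sin x ^ 2 = 1 - cos x ^ 2.
Proof. generalize (sin2_cos2 x). unfold Rsqr. nra. Qed.

Lemma sqrt_spec (x : R) : 0 < x -> 0 < sqrt x /\ sqrt x ^ 2 = x.
Proof.
  intros Hx. split; [now apply sqrt_lt_R0|]. apply pow2_sqrt. lra.
Qed.

Lemma d_cos_bounds (d x : R) : - 3 / 2 < d < 3 / 2 -> - 3 / 2 < d * cos x < 3 / 2.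
Proof.
  intros Hd. generalize (COS_bound x). intros Hc.
  destruct (Rle_or_lt 0 d); split; nra.
Qed.

Lemma radicand_rho_pos (d th : R) :
  - 3 / 2 < d < 3 / 2 -> 0 < (5 / 2 - cos th ^ 2) ^ 2 - d ^ 2.
Proof. intros Hd. generalize (cos_sq_bounds th). nra. Qed.

Lemma root_h_spec (th : R) : 0 < root_h th /\ root_h th ^ 2 = 4 - cos th ^ 2.
Proof. apply sqrt_spec. generalize (cos_sq_bounds th). lra. Qed.

Lemma root_rho_spec (d th : R) : - 3 / 2 < d < 3 / 2 ->
  0 < root_rho d th /\ root_rho d th ^ 2 = (5 / 2 - cos th ^ 2) ^ 2 - d ^ 2.
Proof. intros Hd. now apply sqrt_spec, radicand_rho_pos. Qed.

Lemma root_l_spec (d ph : R) : - 3 / 2 < d < 3 / 2 ->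
  0 < root_l d ph /\ root_l d ph ^ 2 = 5 / 2 + d * cos ph.
Proof. intros Hd. apply sqrt_spec. generalize (d_cos_bounds d ph Hd). lra. Qed.

Lemma root_g_spec (d ph : R) : - 3 / 2 < d < 3 / 2 ->
  0 < root_g d ph /\ root_g d ph ^ 2 = 3 / 2 + d * cos ph.
Proof. intros Hd. apply sqrt_spec. generalize (d_cos_bounds d ph Hd). lra. Qed.

Lemma root_k_spec (d ph : R) : - 3 / 2 < d < 3 / 2 ->
  0 < root_k d ph /\ root_k d ph ^ 2 = 3 / 2 - d * cos ph.
Proof. intros Hd. apply sqrt_spec. generalize (d_cos_bounds d ph Hd). lra. Qed.

(** [weight1] and [weight2] are the holomorphic differentials of the two
    separated coordinates expressed in the angles; [weightK] is the elliptic one,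
    since [root_g * root_k] is the square root of [9/4 - d^2 cos^2]. *)
Definition weight1 (d th : R) : R := / (root_h th * root_rho d th).
Definition weight2 (d ph : R) : R := / (2 * root_l d ph * root_g d ph * root_k d ph).
Definition weightK (d al : R) : R := / (root_g d al * root_k d al).

Lemma sq_le_cancel (x y : R) : 0 <= y -> x ^ 2 <= y ^ 2 -> x <= y.
Proof. intros Hy H. destruct (Rle_or_lt x y); trivial. nra. Qed.

Lemma gk_pos (d x : R) : - 3 / 2 < d < 3 / 2 ->
  0 < root_g d x * root_k d x.
Proof.
  intros Hd. apply Rmult_lt_0_compat; [apply (root_g_spec d x Hd)|apply (root_k_spec d x Hd)].
Qed.

Lemma gk_sq (d x : R) : - 3 / 2 < d < 3 / 2 ->

  (root_g d x * root_k d x) ^ 2 = 9 / 4 - d ^ 2 * cos x ^ 2.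
Proof.
  intros Hd. rewrite Rpow_mult_distr. rewrite (proj2 (root_g_spec d x Hd)),
    (proj2 (root_k_spec d x Hd)). field.
Qed.

Lemma h_rho_pos (d x : R) : - 3 / 2 < d < 3 / 2 ->
  0 < root_h x * root_rho d x.
Proof.
  intros Hd. apply Rmult_lt_0_compat; [apply (root_h_spec x)|apply (root_rho_spec d x Hd)].
Qed.

Lemma h_rho_sq (d x : R) : - 3 / 2 < d < 3 / 2 ->

  (root_h x * root_rho d x) ^ 2
  = (4 - cos x ^ 2) * ((5 / 2 - cos x ^ 2) ^ 2 - d ^ 2).
Proof.
  intros Hd. rewrite Rpow_mult_distr. now rewrite (proj2 (root_h_spec x)),
    (proj2 (root_rho_spec d x Hd)).
Qed.

Lemma K_periods (d : R) (K : R -> R) :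
  - 3 / 2 < d < 3 / 2 -> K 0 = 0 -> (forall x, is_derive K x (weightK d x)) ->
  K (4 * PI) = 2 * K (2 * PI) /\ 0 < K (2 * PI).
Proof.
  intros Hd K0 HK.
  split.
  - assert (E : K (2 * PI + 2 * PI) - K (2 * PI) = K (0 + 2 * PI) - K 0).
    { apply (derive_zero_const (fun x => K (x + 2 * PI) - K x)).
      intros x.
      assert (A := HK x). assert (B := HK (x + 2 * PI)).
      compute_derive. unfold weightK, root_g, root_k.
      rewrite cos_plus, sin_2PI, cos_2PI.
      replace (cos x * 1 - sin x * 0) with (cos x) by ring. ring. }
    rewrite Rplus_0_l in E. replace (4 * PI) with (2 * PI + 2 * PI) by ring. lra.
  - rewrite <- K0. apply (derive_pos_incr K (weightK d)); trivial.
    + intros x. now apply Rinv_0_lt_compat, gk_pos.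
    + generalize PI_RGT_0. lra.
Qed.

(** A periodic primitive of [d cos * weightK]; it shows that this odd part has no
    contribution over a full turn, although it is not small pointwise. *)
Definition odd_part (d al : R) : R :=
  ln (d * sin al + sqrt ((9 / 4 - d ^ 2) + (d * sin al) ^ 2)).

Lemma odd_part_derive (d x : R) : - 3 / 2 < d < 3 / 2 ->

  is_derive (odd_part d) x (d * cos x * weightK d x).
Proof.
  intros Hd. set (r := 9 / 4 - d ^ 2 + (d * sin x) ^ 2).
  assert (Hd2 : 0 < 9 / 4 - d ^ 2) by nra.
  assert (Hr : 0 < r) by (unfold r; generalize (pow2_ge_0 (d * sin x)); lra).
  destruct (sqrt_spec r Hr) as [Hs Hs2].
  assert (Hg := gk_pos d x Hd).
  assert (E : root_g d x * root_k d x = sqrt r).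
  { apply Rsqr_inj; try lra. rewrite !Rsqr_pow2, gk_sq, Hs2 by exact Hd.
    unfold r. rewrite Rpow_mult_distr, sin_sq. ring. }
  assert (Hln : 0 < d * sin x + sqrt r).
  { unfold r in *. set (y := d * sin x) in *.
    set (s := sqrt (9 / 4 - d ^ 2 + y ^ 2)) in *. nra. }
  unfold odd_part, weightK. rewrite E. unfold r in *.
  change ((d * sin x) ^ 2) with (d * sin x * (d * sin x * 1)) in *.
  change (d ^ 2) with (d * (d * 1)) in *.
  auto_derive; [repeat split; assumption|].
  set (y := sqrt (9 / 4 - d * (d * 1) + d * sin x * (d * sin x * 1))) in *.
  field_simplify_eq; [ring|split; lra].
Qed.

(** The function [1/sqrt l2] is convex on [[1,4]]: above it lies its chord, and
    below it the tangent at [l2 = 9/4], which has rational coefficients.  Both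
    bounds are affine in [d cos], so after integration over full turns only their
    constant terms [3/4] and [17/27] survive. *)
Lemma inv_root_l_bounds (d x : R) : - 3 / 2 < d < 3 / 2 ->
  17 / 27 - 4 / 27 * (d * cos x) <= / root_l d x <= 3 / 4 - / 6 * (d * cos x).
Proof.
  intros Hd. destruct (root_l_spec d x Hd) as [Hl El].
  assert (Hb := d_cos_bounds d x Hd).
  set (l := root_l d x) in *.
  replace (d * cos x) with (l ^ 2 - 5 / 2) by lra.
  assert (Hl1 : 1 <= l <= 2) by (split; apply sq_le_cancel; lra).
  split; apply (Rmult_le_reg_r l); trivial; rewrite Rinv_l by lra.
  - generalize (Rmult_le_pos (l + 3) ((2 * l - 3) ^ 2) ltac:(lra) (pow2_ge_0 _)). lra.
  - generalize (Rmult_le_pos ((l - 1) * (2 - l)) (l + 3)). nra.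
Qed.

Lemma weight2_weightK (d x : R) : - 3 / 2 < d < 3 / 2 ->
  weight2 d x = / 2 * / root_l d x * weightK d x.
Proof.
  intros Hd. unfold weight2, weightK.
  destruct (root_l_spec d x Hd), (root_g_spec d x Hd), (root_k_spec d x Hd).
  field. repeat split; lra.
Qed.

Lemma weightK_pos (d x : R) : - 3 / 2 < d < 3 / 2 -> 0 < weightK d x.
Proof. intros Hd. now apply Rinv_0_lt_compat, gk_pos. Qed.

(** With [c = cos^2 x], one has [4 - c >= 3] and
    [(5/2 - c)^2 - d^2 >= 9/4 - d^2 c], the difference of the latter being
    [(1 - c)(4 - c - d^2)].  The constant only has to lie between [1/sqrt 3] and
    [17/27]. *)
Lemma weight1_le (d x : R) : - 3 / 2 < d < 3 / 2 ->
  weight1 d x <= 5 / 8 * weightK d x.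
Proof.
  intros Hd. unfold weight1, weightK.
  assert (H1 := gk_pos d x Hd). assert (H2 := h_rho_pos d x Hd).
  assert (E1 := gk_sq d x Hd). assert (E2 := h_rho_sq d x Hd).
  set (a := root_g d x * root_k d x) in *. set (b := root_h x * root_rho d x) in *.
  assert (Hab : 8 / 5 * a <= b).
  { apply sq_le_cancel; [lra|]. rewrite Rpow_mult_distr, E1, E2.
    generalize (cos_sq_bounds x). set (c := cos x ^ 2). intros Hc.
    assert (Hd2 : 0 <= d ^ 2 < 9 / 4) by nra. set (e := d ^ 2) in *.
    assert (H3 : 9 / 4 - e * c <= (5 / 2 - c) ^ 2 - e) by nra.
    assert (H4 : 0 < 9 / 4 - e * c) by nra. nra. }
  apply (Rmult_le_reg_r (a * b)); [now apply Rmult_lt_0_compat|].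
  replace (/ b * (a * b)) with a by (field; lra).
  replace (5 / 8 * / a * (a * b)) with (5 / 8 * b) by (field; lra). lra.
Qed.

(** No multiple of [weightK x] with a factor above [3/8] is below [weight1 x]
    pointwise: for [d = 0] and [cos x = 0] the quotient is only [3/10].  It is so
    after the change of angle [tan (twist x) = (9/7) tan x], written here by a
    formula valid for all [x]; this change preserves full turns.  At [d = 0] the
    ideal factor would be [sqrt (5/3)], which makes [(5/2 - cos^2) * twist']
    constant; [9/7] is a rational number close to it. *)
Definition twist (x : R) : R := x + atan (2 * sin x * cos x / (7 + 2 * sin x ^ 2)).

Lemma twist_derive (x : R) : is_derive twist x (63 / (81 - 32 * cos x ^ 2)).
Proof.
  unfold twist. auto_derive.
  - nra.
  - generalize (sin_sq x) (cos_sq_bounds x). intros Hs Hc.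
    replace (sin x * (sin x * 1)) with (1 - cos x ^ 2) by (rewrite <- sin_sq; ring).
    field_simplify_eq.
    + replace (sin x ^ 4) with ((sin x ^ 2) ^ 2) by ring. rewrite ?Hs. ring.
    + nra.
Qed.

(** Both this and [twist_derive] are rational in [cos^2 x], which reduces
    [weight1_ge] to a polynomial inequality. *)
Lemma twist_cos_sq (x : R) : cos (twist x) ^ 2 = 49 * cos x ^ 2 / (81 - 32 * cos x ^ 2).
Proof.
  unfold twist. rewrite cos_plus, cos_atan, sin_atan.
  set (y := 2 * sin x * cos x / (7 + 2 * sin x ^ 2)).
  assert (Hr : 0 < 1 + y²) by (generalize (Rle_0_sqr y); lra).
  destruct (sqrt_spec _ Hr) as [Hs Es]. set (r := sqrt (1 + y²)) in *.
  replace ((cos x * (1 / r) - sin x * (y / r)) ^ 2)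
    with ((cos x - sin x * y) ^ 2 / r ^ 2) by (field; lra).
  rewrite Es. unfold Rsqr, y.
  generalize (sin_sq x) (cos_sq_bounds x). intros H1 H2.
  field_simplify_eq.
  - replace (sin x ^ 4) with ((sin x ^ 2) ^ 2) by ring.
    replace (sin x ^ 6) with ((sin x ^ 2) ^ 3) by ring. rewrite H1. ring.
  - repeat split; try nra.
Qed.

(** The constant [19/50] exceeds [3/8], the upper bound for the other period. *)
Lemma weight1_ge (d x : R) : - 3 / 2 < d < 3 / 2 ->
  19 / 50 * (63 / (81 - 32 * cos x ^ 2) * weightK d (twist x)) <= weight1 d x.
Proof.
  intros Hd. unfold weight1, weightK.
  assert (H1 := gk_pos d (twist x) Hd). assert (H2 := h_rho_pos d x Hd).
  assert (E1 := gk_sq d (twist x) Hd). assert (E2 := h_rho_sq d x Hd).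
  rewrite twist_cos_sq in E1.
  set (a := root_g d (twist x) * root_k d (twist x)) in *.
  set (b := root_h x * root_rho d x) in *.
  generalize (cos_sq_bounds x). set (c := cos x ^ 2) in *. intros Hc.
  set (D := 81 - 32 * c) in *.
  assert (HD : 0 < D) by (unfold D; lra).
  assert (Hd2 : 0 <= d ^ 2 < 9 / 4) by nra. set (e := d ^ 2) in *.
  assert (Hab : 1197 / 50 * b <= D * a).
  { apply sq_le_cancel; [nra|]. rewrite !Rpow_mult_distr, E1, E2.
    replace (D ^ 2 * (9 / 4 - e * (49 * c / D)))
      with (D * (9 / 4 * D - 49 * e * c)) by (field; lra).
    unfold D.
    (* The difference is affine in [e = d^2], so only the two ends [0] and [9/4] of
       its range matter. *)
    assert (He : forall P Q, 0 <= P -> 0 <= P + 9 / 4 * Q -> 0 <= P + e * Q).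
    { intros P Q HP HQ. destruct (Rle_or_lt 0 Q); nra. }
    apply Rminus_le_0.
    replace ((81 - 32 * c) * (9 / 4 * (81 - 32 * c) - 49 * e * c) -
      (1197 / 50) ^ 2 * ((4 - c) * ((5 / 2 - c) ^ 2 - e)))
      with ((9 / 4 * (81 - 32 * c) ^ 2 - (1197 / 50) ^ 2 * ((4 - c) * (5 / 2 - c) ^ 2))
        + e * ((1197 / 50) ^ 2 * (4 - c) - 49 * c * (81 - 32 * c))) by ring.
    apply He.
    - assert (H3 : 0 <= (3 / 2 * (81 - 32 * c)) ^ 2 - (1197 / 25 * (5 / 2 - c)) ^ 2)
        by nra.
      assert (H4 : 0 <= c * (5 / 2 - c) ^ 2)
        by (apply Rmult_le_pos; [lra|apply pow2_ge_0]).
      nra.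
    - match goal with |- 0 <= ?X =>
        replace X with ((1 - c) * (729 / 4 * (81 - 32 * c) - (1197 / 50 * (4 - c)) ^ 2))
          by field end.
      apply Rmult_le_pos; nra. }
  apply (Rmult_le_reg_r (D * a * b)).
  { apply Rmult_lt_0_compat; [now apply Rmult_lt_0_compat|trivial]. }
  replace (/ b * (D * a * b)) with (D * a) by (field; lra).
  replace (19 / 50 * (63 / D * / a) * (D * a * b)) with (1197 / 50 * b)
    by (field; lra). lra.
Qed.

(** In units of the complete integral [K (2 * PI)] of [weightK]: one turn of [ph]
    costs at most [3/8], one turn of [th] costs between [19/50] and [5/8], and two
    turns of [ph] cost at least [17/27]. *)
Lemma periods_interlace (d : R) (F1 F2 : R -> R) : - 3 / 2 < d < 3 / 2 ->
  F1 0 = 0 -> F2 0 = 0 ->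
  (forall x, is_derive F1 x (weight1 d x)) ->
  (forall x, is_derive F2 x (weight2 d x)) ->
  F2 (2 * PI) < F1 (2 * PI) < F2 (4 * PI).
Proof.
  intros Hd F10 F20 HF1 HF2.
  assert (Hpi := PI_RGT_0).
  destruct (exists_antiderivative (weightK d)) as (K & K0 & HK).
  { intros x. unfold weightK, root_g, root_k.
    generalize (d_cos_bounds d x Hd) (gk_pos d x Hd). unfold root_g, root_k.
    intros H1 H2. auto_derive. repeat split; try lra. exact (Rgt_not_eq _ _ H2). }
  destruct (K_periods d K Hd K0 HK) as [K4 K2].
  assert (P2 : odd_part d (2 * PI) = odd_part d 0)
    by (unfold odd_part; now rewrite sin_2PI, sin_0).
  assert (P4 : odd_part d (4 * PI) = odd_part d 0).
  { unfold odd_part. replace (4 * PI) with (0 + 2 * INR 2 * PI) by (simpl; ring).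
    now rewrite sin_period. }
  assert (B2 : F2 (2 * PI) <= 3 / 8 * K (2 * PI)).
  { enough (3 / 8 * K 0 - / 12 * odd_part d 0 - F2 0
      <= 3 / 8 * K (2 * PI) - / 12 * odd_part d (2 * PI) - F2 (2 * PI)) by lra.
    apply (derive_nonneg_incr (fun x => 3 / 8 * K x - / 12 * odd_part d x - F2 x)
      (fun x => 3 / 8 * weightK d x - / 12 * (d * cos x * weightK d x) - weight2 d x)).
    - intros x. assert (A := HK x). assert (B := HF2 x).
      assert (C := odd_part_derive d x Hd). compute_derive. ring.
    - intros x. rewrite weight2_weightK by exact Hd.
      generalize (inv_root_l_bounds d x Hd) (weightK_pos d x Hd). nra.
    - lra. }
  assert (B4 : 17 / 27 * K (2 * PI) <= F2 (4 * PI)).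
  { enough (F2 0 - 17 / 54 * K 0 + 2 / 27 * odd_part d 0
      <= F2 (4 * PI) - 17 / 54 * K (4 * PI) + 2 / 27 * odd_part d (4 * PI)) by lra.
    apply (derive_nonneg_incr (fun x => F2 x - 17 / 54 * K x + 2 / 27 * odd_part d x)
      (fun x => weight2 d x - 17 / 54 * weightK d x
                + 2 / 27 * (d * cos x * weightK d x))).
    - intros x. assert (A := HK x). assert (B := HF2 x).
      assert (C := odd_part_derive d x Hd). compute_derive. ring.
    - intros x. rewrite weight2_weightK by exact Hd.
      generalize (inv_root_l_bounds d x Hd) (weightK_pos d x Hd). nra.
    - lra. }
  assert (B1 : F1 (2 * PI) <= 5 / 8 * K (2 * PI)).
  { enough (5 / 8 * K 0 - F1 0 <= 5 / 8 * K (2 * PI) - F1 (2 * PI)) by lra.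
    apply (derive_nonneg_incr (fun x => 5 / 8 * K x - F1 x)
      (fun x => 5 / 8 * weightK d x - weight1 d x)).
    - intros x. assert (A := HK x). assert (B := HF1 x). compute_derive. ring.
    - intros x. generalize (weight1_le d x Hd). lra.
    - lra. }
  assert (B1' : 19 / 50 * K (2 * PI) <= F1 (2 * PI)).
  { assert (T0 : twist 0 = 0).
    { unfold twist. rewrite sin_0. replace (2 * 0 * cos 0 / (7 + 2 * 0 ^ 2)) with 0
        by (field; lra). rewrite atan_0. ring. }
    assert (T2 : twist (2 * PI) = 2 * PI).
    { unfold twist. rewrite sin_2PI.
      replace (2 * 0 * cos (2 * PI) / (7 + 2 * 0 ^ 2)) with 0
        by (field; lra). rewrite atan_0. ring. }
    enough (F1 0 - 19 / 50 * K (twist 0) <= F1 (2 * PI) - 19 / 50 * K (twist (2 * PI)))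
      by (rewrite T0, T2 in *; lra).
    apply (derive_nonneg_incr (fun x => F1 x - 19 / 50 * K (twist x))
      (fun x => weight1 d x
                - 19 / 50 * (63 / (81 - 32 * cos x ^ 2) * weightK d (twist x)))).
    - intros x. assert (A := HK (twist x)). assert (B := HF1 x).
      assert (C := twist_derive x). compute_derive. ring.
    - intros x. generalize (weight1_ge d x Hd). lra.
    - lra. }
  lra.
Qed.

(** * The solution in separated coordinates *)

(** The difference [l2 - l1], which relates the separated parameter to time. *)
Definition gap (d th ph : R) : R := 5 / 2 + d * cos ph - cos th ^ 2.

Definition orbit_u (d th ph : R) : R := sin th * root_g d ph / sqrt 3.
Definition orbit_v (d th ph : R) : R := root_h th * root_k d ph / sqrt 3.

(** The velocities, by the chain rule: in the parameter [s] with
    [dt = gap * ds] all the derivatives of the roots are polynomials in the other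
    roots. *)
Definition orbit_u1 (d th ph : R) : R :=
  (cos th * root_h th * root_rho d th * root_g d ph
   - sin th * (d * sin ph) * root_l d ph * root_k d ph) / (sqrt 3 * gap d th ph).
Definition orbit_v1 (d th ph : R) : R :=
  (sin th * cos th * root_rho d th * root_k d ph
   + root_h th * (d * sin ph) * root_l d ph * root_g d ph) / (sqrt 3 * gap d th ph).

Lemma gap_pos (d th ph : R) : - 3 / 2 < d < 3 / 2 -> 0 < gap d th ph.
Proof.
  intros Hd. unfold gap.
  generalize (d_cos_bounds d ph Hd) (cos_sq_bounds th). lra.
Qed.

Definition follows_angles (d : R) (th ph : R -> R) : Prop :=
  forall t,
    is_derive th t (root_h (th t) * root_rho d (th t) / gap d (th t) (ph t)) /\
    is_derive ph t (2 * root_l d (ph t) * root_g d (ph t) * root_k d (ph t)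
                    / gap d (th t) (ph t)).

Lemma is_derive_root (f : R -> R) (t l m : R) :
  is_derive f t l -> 0 < sqrt (f t) -> l = 2 * sqrt (f t) * m ->
  is_derive (fun s => sqrt (f s)) t m.
Proof.
  intros Df Hr El.
  assert (Hf : 0 < f t).
  { destruct (Rle_or_lt (f t) 0) as [H|H]; trivial.
    rewrite sqrt_neg_0 in Hr; lra. }
  replace m with (l / (2 * sqrt (f t))) by (rewrite El; field; lra).
  now apply is_derive_sqrt.
Qed.

(** Reduces the derivative of a velocity to a polynomial identity. *)
Ltac second_derivative :=
  auto_derive;
  [ repeat split; try (eexists; eassumption);
    apply Rmult_integral_contrapositive; split; lra |];
  rewrite_derive;
  field_simplify_eq; [| split; lra].

(** The roots enter only through their squares and their derivatives, so they are
    taken here as unknown functions; [w] stands for [d sin ph] and [E] for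
    [25/4 - d^2].  The verification is then a polynomial identity modulo the
    relations for the squares. *)
Lemma separated_motion_derivatives (E t : R) (th h r l g k w N : R -> R) :
  0 < N t ->
  h t ^ 2 = 4 - cos (th t) ^ 2 -> r t ^ 2 = cos (th t) ^ 4 - 5 * cos (th t) ^ 2 + E ->
  g t ^ 2 = l t ^ 2 - 1 -> k t ^ 2 = 4 - l t ^ 2 ->
  w t ^ 2 = 5 * l t ^ 2 - l t ^ 4 - E ->
  (forall s, N s = l s ^ 2 - cos (th s) ^ 2) ->
  is_derive th t (h t * r t / N t) ->
  is_derive h t (sin (th t) * cos (th t) * r t / N t) ->
  is_derive r t ((5 - 2 * cos (th t) ^ 2) * sin (th t) * cos (th t) * h t / N t) ->
  is_derive l t (- w t * g t * k t / N t) ->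
  is_derive g t (- w t * l t * k t / N t) ->
  is_derive k t (w t * l t * g t / N t) ->
  is_derive w t ((2 * l t ^ 2 - 5) * l t * g t * k t / N t) ->
  let u := fun s => sin (th s) * g s / sqrt 3 in
  let v := fun s => h s * k s / sqrt 3 in
  let u1 := fun s => (cos (th s) * h s * r s * g s
    - sin (th s) * w s * l s * k s) / (sqrt 3 * N s) in
  let v1 := fun s => (sin (th s) * cos (th s) * r s * k s
    + h s * w s * l s * g s) / (sqrt 3 * N s) in
  is_derive u t (u1 t) /\ is_derive v t (v1 t) /\
  is_derive u1 t ((1 - 2 * (u t ^ 2 + v t ^ 2)) * u t) /\
  is_derive v1 t ((4 - 2 * (u t ^ 2 + v t ^ 2)) * v t).
Proof.
  intros HN Eh Er Eg Ek Ew EN Dth Dh Dr Dl Dg Dk Dw u v u1 v1.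
  assert (H3 : 0 < sqrt 3) by (apply sqrt_lt_R0; lra).
  assert (E3 : sqrt 3 ^ 2 = 3) by (apply pow2_sqrt; lra).
  assert (ES := sin_sq (th t)).
  assert (DN : is_derive N t (2 * cos (th t) * sin (th t) * h t * r t / N t
     - 2 * w t * l t * g t * k t / N t)).
  { apply (is_derive_ext (fun s => l s ^ 2 - cos (th s) ^ 2)).
    - intros s. symmetry. apply EN.
    - compute_derive. field. lra. }
  specialize (EN t).
  split; [|split; [|split]].
  - unfold u, u1. compute_derive. field. lra.
  - unfold v, v1. compute_derive. field. lra.
  - unfold u1, u, v. second_derivative.
    rewrite EN. ring [Eh Er Eg Ek Ew ES E3].
  - unfold v1, u, v. second_derivative.
    rewrite EN. ring [Eh Er Eg Ek Ew ES E3].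
Qed.

Lemma angles_flow (d : R) (th ph : R -> R) :
  - 3 / 2 < d < 3 / 2 -> follows_angles d th ph ->
  is_flow (fun t => orbit_u d (th t) (ph t)) (fun t => orbit_v d (th t) (ph t))
    (fun t => orbit_u1 d (th t) (ph t)) (fun t => orbit_v1 d (th t) (ph t)).
Proof.
  intros Hd Ha t. destruct (Ha t) as [Dth Dph]; clear Ha.
  assert (HN := gap_pos d (th t) (ph t) Hd).
  set (N := gap d (th t) (ph t)) in *.
  destruct (root_h_spec (th t)) as [Hh Eh].
  destruct (root_rho_spec d (th t) Hd) as [Hr Er].
  destruct (root_l_spec d (ph t) Hd) as [Hl El].
  destruct (root_g_spec d (ph t) Hd) as [Hg Eg].
  destruct (root_k_spec d (ph t) Hd) as [Hk Ek].
  assert (Dh : is_derive (fun t => root_h (th t)) t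
    (sin (th t) * cos (th t) * root_rho d (th t) / N)).
  { apply (is_derive_root (fun t => 4 - cos (th t) ^ 2) t
      (2 * cos (th t) * sin (th t) * (root_h (th t) * root_rho d (th t) / N))).
    - compute_derive. ring.
    - exact Hh.
    - fold (root_h (th t)). field. lra. }
  assert (Dr : is_derive (fun t => root_rho d (th t)) t
    ((5 - 2 * cos (th t) ^ 2) * sin (th t) * cos (th t) * root_h (th t) / N)).
  { apply (is_derive_root (fun t => (5 / 2 - cos (th t) ^ 2) ^ 2 - d ^ 2) t
      (4 * (5 / 2 - cos (th t) ^ 2) * cos (th t) * sin (th t)
       * (root_h (th t) * root_rho d (th t) / N))).
    - compute_derive. simpl. field. lra.
    - exact Hr.
    - fold (root_rho d (th t)). field. lra. }
  assert (Dl : is_derive (fun t => root_l d (ph t)) t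
    (- (d * sin (ph t)) * root_g d (ph t) * root_k d (ph t) / N)).
  { apply (is_derive_root (fun t => 5 / 2 + d * cos (ph t)) t
      (- (d * sin (ph t)) *
       (2 * root_l d (ph t) * root_g d (ph t) * root_k d (ph t) / N))).
    - compute_derive. field. lra.
    - exact Hl.
    - fold (root_l d (ph t)). field. lra. }
  assert (Dg : is_derive (fun t => root_g d (ph t)) t
    (- (d * sin (ph t)) * root_l d (ph t) * root_k d (ph t) / N)).
  { apply (is_derive_root (fun t => 3 / 2 + d * cos (ph t)) t
      (- (d * sin (ph t)) *
       (2 * root_l d (ph t) * root_g d (ph t) * root_k d (ph t) / N))).
    - compute_derive. field. lra.
    - exact Hg.
    - fold (root_g d (ph t)). field. lra. }
  assert (Dk : is_derive (fun t => root_k d (ph t)) t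
    (d * sin (ph t) * root_l d (ph t) * root_g d (ph t) / N)).
  { apply (is_derive_root (fun t => 3 / 2 - d * cos (ph t)) t
      (d * sin (ph t) *
       (2 * root_l d (ph t) * root_g d (ph t) * root_k d (ph t) / N))).
    - compute_derive. field. lra.
    - exact Hk.
    - fold (root_k d (ph t)). field. lra. }
  assert (Dw : is_derive (fun t => d * sin (ph t)) t
    ((2 * root_l d (ph t) ^ 2 - 5) * root_l d (ph t) * root_g d (ph t)
     * root_k d (ph t) / N)).
  { compute_derive. rewrite El. field. lra. }
  apply (separated_motion_derivatives (25 / 4 - d ^ 2) t th (fun t => root_h (th t))
    (fun t => root_rho d (th t)) (fun t => root_l d (ph t))
    (fun t => root_g d (ph t)) (fun t => root_k d (ph t)) (fun t => d * sin (ph t))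
    (fun t => gap d (th t) (ph t))); trivial.
  - rewrite Er. field.
  - rewrite Eg, El. field.
  - rewrite Ek, El. field.
  - replace (root_l d (ph t) ^ 4) with ((root_l d (ph t) ^ 2) ^ 2) by ring.
    rewrite El, Rpow_mult_distr, sin_sq. field.
  - intros s. unfold gap. now rewrite (proj2 (root_l_spec d (ph s) Hd)).
Qed.

(** * Existence by quadratures *)

Lemma weight1_differentiable (d x : R) :
  - 3 / 2 < d < 3 / 2 -> ex_derive (weight1 d) x.
Proof.
  intros Hd. assert (Hp := h_rho_pos d x Hd).
  destruct (root_h_spec x) as [H1 E1]. destruct (root_rho_spec d x Hd) as [H2 E2].
  assert (H3 := radicand_rho_pos d x Hd). assert (H4 := cos_sq_bounds x).
  unfold weight1, root_h, root_rho in *.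
  apply (ex_derive_inv (fun x => _ * _)); [|lra].
  apply (ex_derive_mult (fun x => sqrt _) (fun x => sqrt _)); auto_derive.
  - simpl in *; lra.
  - simpl in *; lra.
Qed.

Lemma weight2_differentiable (d x : R) :
  - 3 / 2 < d < 3 / 2 -> ex_derive (weight2 d) x.
Proof.
  intros Hd. assert (H1 := gk_pos d x Hd).
  destruct (root_l_spec d x Hd) as [H2 _]. assert (H3 := d_cos_bounds d x Hd).
  assert (H4 : 0 < 2 * root_l d x * root_g d x * root_k d x).
  { rewrite Rmult_assoc. apply Rmult_lt_0_compat; lra. }
  unfold weight2. apply (ex_derive_inv (fun x => 2 * _ * _ * _)); [|lra].
  unfold root_l, root_g, root_k. auto_derive. repeat split; lra.
Qed.

(** Since [weight1 dth = weight2 dph], the angle [ph] is the function [Phi] of [th]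
    obtained by inverting the primitive of [weight2].  The time [clock] as a
    function of [th] is then another primitive, and [th] is its inverse. *)
Lemma angles_exist (d : R) : - 3 / 2 < d < 3 / 2 ->
  exists th ph clock F1 F2 : R -> R,
    follows_angles d th ph /\ th 0 = 0 /\ ph 0 = 0 /\
    (forall t, clock (th t) = t) /\ (forall x, th (clock x) = x) /\
    (forall x, is_derive clock x
       (gap d x (ph (clock x)) / (root_h x * root_rho d x))) /\
    F1 0 = 0 /\ F2 0 = 0 /\
    (forall x, is_derive F1 x (weight1 d x)) /\
    (forall x, is_derive F2 x (weight2 d x)) /\
    (forall t, F2 (ph t) = F1 (th t)).
Proof.
  intros Hd.
  destruct (exists_antiderivative (weight1 d)) as (F1 & F10 & HF1).
  { intros x. now apply weight1_differentiable. }
  destruct (exists_antiderivative (weight2 d)) as (F2 & F20 & HF2).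
  { intros x. now apply weight2_differentiable. }
  destruct (differentiable_inverse F2 (weight2 d) (/ 16)) as (G & FG & GF & HG);
    [lra | exact HF2 | |].
  { intros x. unfold weight2.
    destruct (root_l_spec d x Hd) as [H1 E1]. destruct (root_g_spec d x Hd) as [H2 E2].
    destruct (root_k_spec d x Hd) as [H3 E3]. assert (H4 := d_cos_bounds d x Hd).
    assert (L1 : root_l d x <= 2) by (apply sq_le_cancel; lra).
    assert (L2 : root_g d x <= 2) by (apply sq_le_cancel; lra).
    assert (L3 : root_k d x <= 2) by (apply sq_le_cancel; lra).
    assert (L4 := gk_pos d x Hd).
    assert (L5 : root_g d x * root_k d x <= 4) by nra.
    rewrite Rmult_assoc. apply Rinv_le_contravar; nra. }
  set (Phi := fun x => G (F1 x)).
  assert (HPhi : forall x, is_derive Phi x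
    (2 * root_l d (Phi x) * root_g d (Phi x) * root_k d (Phi x) * weight1 d x)).
  { intros x. assert (A := HF1 x). assert (B := HG (F1 x)). unfold Phi.
    compute_derive. unfold weight2. rewrite Rinv_inv. ring. }
  destruct (exists_antiderivative
    (fun x => gap d x (Phi x) / (root_h x * root_rho d x))) as (clock & C0 & HC).
  { intros x. assert (A := HPhi x). destruct (weight1_differentiable d x Hd) as [w B].
    unfold gap. apply (ex_derive_ext
      (fun x => (5 / 2 + d * cos (Phi x) - cos x ^ 2) * weight1 d x)).
    - intros y. reflexivity.
    - auto_derive. repeat split; eexists; eassumption. }
  set (e := 3 / 2 - Rabs d).
  assert (He : 0 < e) by (unfold e; generalize (Rabs_def1 d (3 / 2)); lra).
  destruct (differentiable_inverse clock
    (fun x => gap d x (Phi x) / (root_h x * root_rho d x)) (e / 5))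
    as (th & Cth & thC & Hth); [lra | exact HC | |].
  { intros x. assert (H1 := h_rho_pos d x Hd).
    destruct (root_h_spec x) as [H2 E2]. destruct (root_rho_spec d x Hd) as [H3 E3].
    assert (H4 := cos_sq_bounds x).
    assert (L1 : root_h x <= 2) by (apply sq_le_cancel; lra).
    assert (L2 : root_rho d x <= 5 / 2).
    { apply sq_le_cancel; [lra|]. rewrite E3. nra. }
    assert (L3 : e <= gap d x (Phi x)).
    { unfold e, gap. generalize (COS_bound (Phi x)) (Rle_abs d) (Rle_abs (- d)).
      rewrite Rabs_Ropp. intros. nra. }
    apply (Rmult_le_reg_r (root_h x * root_rho d x)); trivial.
    replace (gap d x (Phi x) / (root_h x * root_rho d x) * (root_h x * root_rho d x))
      with (gap d x (Phi x)) by (field; lra).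
    assert (L4 : root_h x * root_rho d x <= 5) by nra.
    set (b := root_h x * root_rho d x) in *. nra. }
  exists th, (fun t => Phi (th t)), clock, F1, F2.
  assert (th0 : th 0 = 0)
    by (transitivity (th (clock 0)); [now rewrite C0 | apply thC]).
  refine (conj _ (conj th0 (conj _ (conj Cth (conj thC (conj _
    (conj F10 (conj F20 (conj HF1 (conj HF2 _)))))))))).
  - intros t. assert (A := Hth t). assert (B := HPhi (th t)).
    assert (HN := gap_pos d (th t) (Phi (th t)) Hd).
    assert (Hp := h_rho_pos d (th t) Hd).
    destruct (root_h_spec (th t)) as [H2 E2].
    destruct (root_rho_spec d (th t) Hd) as [H3 E3].
    split.
    + replace (root_h (th t) * root_rho d (th t) / gap d (th t) (Phi (th t)))
        with (/ (gap d (th t) (Phi (th t)) / (root_h (th t) * root_rho d (th t))))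
        by (field; repeat split; lra).
      exact A.
    + compute_derive. unfold weight1. field. repeat split; lra.
  - rewrite th0. unfold Phi. rewrite F10.
    transitivity (G (F2 0)); [now rewrite F20 | apply GF].
  - intros x. simpl. rewrite thC. apply HC.
  - intros t. apply FG.
Qed.

(** * Large initial values *)

Lemma negative_derive_drop (f : R -> R) (x l : R) :
  is_derive f x l -> l < 0 ->
  exists e, 0 < e /\ forall h, 0 < h < e -> f (x + h) < f x < f (x - h).
Proof.
  intros Hf Hl. apply is_derive_Reals in Hf.
  destruct (Hf (- l) ltac:(lra)) as [[e He] Hd]. simpl in Hd.
  exists e. split; trivial. intros h Hh. split.
  - specialize (Hd h ltac:(lra)). rewrite Rabs_pos_eq in Hd by lra.
    specialize (Hd ltac:(lra)). apply Rabs_def2 in Hd.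
    assert (E : (f (x + h) - f x) / h * h = f (x + h) - f x) by (field; lra).
    nra.
  - specialize (Hd (- h) ltac:(lra)). rewrite Rabs_left in Hd by lra.
    specialize (Hd ltac:(lra)). apply Rabs_def2 in Hd.
    assert (E : (f (x + - h) - f x) / - h * h = f x - f (x - h))
      by (unfold Rminus; field; lra).
    nra.
Qed.

Lemma critical_concave_drop (v v1 : R -> R) (x l : R) :
  (forall t, is_derive v t (v1 t)) -> is_derive v1 x l -> v1 x = 0 -> l < 0 ->
  exists e, 0 < e /\ forall h, 0 < h < e -> v (x + h) < v x.
Proof.
  intros Hv Hv1 H0 Hl. destruct (negative_derive_drop v1 x l Hv1 Hl) as (e & He & Hd).
  exists e. split; trivial. intros h Hh.
  destruct (MVT_cor2 v v1 x (x + h)) as (c & Ec & Hc); [lra| |].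
  - intros y _. apply is_derive_Reals, Hv.
  - destruct (Hd (c - x)) as [H1 _]; [lra|].
    replace (x + (c - x)) with c in H1 by ring. nra.
Qed.

(** Put [F = 16/3 p^4 - 4 p^2 >= 0].  Eliminating [u1] between the two integrals
    gives [v^2 ((r - 3)(r - 4) + 3 (r - v^2)) + F (12 - 3 v^2) = 0] with
    [r = u^2 + v^2], and for [r <= 2] the left side is positive. *)
Lemma critical_point_concave (p u v u1 v1 : R) :
  3 / 4 <= p ^ 2 -> 0 < v -> v1 = 0 ->
  integral_u u v u1 v1 = 4 * p ^ 2 - 16 / 3 * p ^ 4 ->
  energy u v u1 v1 = 8 * p ^ 4 - 6 * p ^ 2 ->
  4 - 2 * (u ^ 2 + v ^ 2) < 0.
Proof.
  intros Hp Hv -> HF HE. unfold integral_u, energy in *.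
  destruct (Rlt_or_le (4 - 2 * (u ^ 2 + v ^ 2)) 0) as [H|H]; trivial. exfalso.
  set (F := 16 / 3 * p ^ 4 - 4 * p ^ 2).
  assert (HFpos : 0 <= F) by (unfold F; replace (p ^ 4) with (p ^ 2 * p ^ 2) by ring; nra).
  set (r := u ^ 2 + v ^ 2) in *.
  assert (Hr : v ^ 2 <= r <= 2)
    by (generalize (pow2_ge_0 u); unfold r in *; lra).
  assert (Hv2 : 0 < v ^ 2) by nra.
  assert (Hid : v ^ 2 * ((r - 3) * (r - 4) + 3 * (r - v ^ 2)) + F * (12 - 3 * v ^ 2) = 0).
  { assert (A : v ^ 2 * u1 ^ 2 = 12 * v ^ 2 - 3 * v ^ 2 * r + 12 * F)
      by (unfold F, r in *; lra).
    assert (B : u1 ^ 2 - u ^ 2 + u ^ 2 * r - v ^ 2 * u1 ^ 2 / 3 = - F)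
      by (unfold F, r in *; lra).
    assert (C : v ^ 2 * u1 ^ 2 - v ^ 2 * u ^ 2 + v ^ 2 * u ^ 2 * r
                - v ^ 2 * (v ^ 2 * u1 ^ 2) / 3 = - F * v ^ 2)
      by (rewrite <- B; field).
    rewrite A in C. unfold r in *. lra. }
  assert (0 < (r - 3) * (r - 4)) by nra.
  nra.
Qed.

(** The start is itself a strict local maximum of [v], so the minimum over a period
    is attained in the interior; it is a critical point where [v] is strictly
    concave, a contradiction. *)
Lemma positive_flow_not_periodic (p T : R) (u v u1 v1 : R -> R) :
  0 < p -> 3 / 4 <= p ^ 2 -> is_flow u v u1 v1 -> starts_at p u v u1 v1 ->
  (forall t, 0 < v t) -> 0 < T -> v T = v 0 -> False.
Proof.
  intros Hp Hp2 Hf (E1 & E2 & E3 & E4) Hv HT EvT.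
  assert (Hv1 : forall t, is_derive v t (v1 t)) by (intro t; apply Hf).
  assert (Hdrop : forall x, v1 x = 0 ->
    exists e, 0 < e /\ forall h, 0 < h < e -> v (x + h) < v x).
  { intros x Hx. destruct (Hf x) as (_ & _ & _ & H2).
    apply (critical_concave_drop v v1 x _ Hv1 H2 Hx).
    enough (4 - 2 * (u x ^ 2 + v x ^ 2) < 0) by (specialize (Hv x); nra).
    apply (critical_point_concave p _ _ (u1 x) (v1 x)); trivial.
    - rewrite (integral_u_conserved _ _ _ _ Hf x), E1, E2, E3, E4.
      unfold integral_u. field.
    - rewrite (energy_conserved _ _ _ _ Hf x), E1, E2, E3, E4.
      unfold energy. field. }
  destruct (continuity_ab_min v 0 T) as (m & Hmin & Hm); [lra| |].
  { intros c _. exact (is_derive_continuity v v1 Hv1 c). }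
  destruct (Hdrop 0 E4) as (e & He & Hd).
  assert (Hh : exists h, 0 < h < e /\ h < T).
  { exists (Rmin e T / 2). generalize (Rmin_l e T) (Rmin_r e T) (Rmin_pos e T He HT). lra. }
  destruct Hh as (h & Hh & HhT). specialize (Hd h Hh). rewrite Rplus_0_l in Hd.
  assert (Hlow : v m < v 0) by (specialize (Hmin h ltac:(lra)); lra).
  assert (Hint : 0 < m < T).
  { split.
    - destruct (Req_dec m 0) as [->|]; lra.
    - destruct (Req_dec m T) as [->|]; lra. }
  assert (Hsmall : forall e, 0 < e -> exists h, 0 < h < e /\ 0 <= m - h /\ m + h <= T).
  { intros a Ha. set (b := Rmin a (Rmin m (T - m))).
    assert (Hb : 0 < b) by (unfold b; repeat apply Rmin_pos; lra).
    generalize (Rmin_l a (Rmin m (T - m))) (Rmin_r a (Rmin m (T - m)))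
      (Rmin_l m (T - m)) (Rmin_r m (T - m)). fold b. intros.
    exists (b / 2). lra. }
  assert (Hcrit : v1 m = 0).
  { destruct (Rtotal_order (v1 m) 0) as [H|[H|H]]; trivial; exfalso.
    - destruct (negative_derive_drop v m (v1 m) (Hv1 m) H) as (a & Ha & Hda).
      destruct (Hsmall a Ha) as (b & Hb & Hb1 & Hb2).
      specialize (Hda b Hb). specialize (Hmin (m + b) ltac:(lra)). lra.
    - destruct (negative_derive_drop (fun t => - v t) m (- v1 m)) as (a & Ha & Hda).
      + apply (is_derive_opp v), Hv1.
      + lra.
      + destruct (Hsmall a Ha) as (b & Hb & Hb1 & Hb2).
        specialize (Hda b Hb). specialize (Hmin (m - b) ltac:(lra)). lra. }
  destruct (Hdrop m Hcrit) as (a & Ha & Hda).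
  destruct (Hsmall a Ha) as (b & Hb & Hb1 & Hb2).
  specialize (Hda b Hb). specialize (Hmin (m + b) ltac:(lra)). lra.
Qed.

(** * Small initial values *)

Lemma orbit_flow (p : R) : 0 < p -> p ^ 2 < 3 / 4 ->
  forall th ph, let d := 3 / 2 - 4 * p ^ 2 in
  follows_angles d th ph -> th 0 = 0 -> ph 0 = 0 ->
  is_flow (fun t => orbit_u d (th t) (ph t)) (fun t => orbit_v d (th t) (ph t))
    (fun t => orbit_u1 d (th t) (ph t)) (fun t => orbit_v1 d (th t) (ph t)) /\
  starts_at p (fun t => orbit_u d (th t) (ph t)) (fun t => orbit_v d (th t) (ph t))
    (fun t => orbit_u1 d (th t) (ph t)) (fun t => orbit_v1 d (th t) (ph t)).
Proof.
  intros Hp Hp2 th ph d Ha Hth Hph.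
  assert (Hd : - 3 / 2 < d < 3 / 2) by (unfold d; nra).
  split; [now apply angles_flow|].
  assert (H3 := sqrt_spec 3 ltac:(lra)).
  destruct (root_g_spec d 0 Hd) as [Hg Eg].
  destruct (root_k_spec d 0 Hd) as [Hk Ek].
  unfold starts_at, orbit_u, orbit_v, orbit_u1, orbit_v1. rewrite Hth, Hph.
  assert (Ek' : root_k d 0 = 2 * p).
  { apply Rsqr_inj; [lra|lra|]. rewrite !Rsqr_pow2, Ek, cos_0. unfold d. ring. }
  assert (Eh : root_h 0 = sqrt 3)
    by (unfold root_h; rewrite cos_0; f_equal; ring).
  assert (Er : root_rho d 0 = root_g d 0 * root_k d 0).
  { apply Rsqr_inj; [apply sqrt_pos|nra|].
    rewrite !Rsqr_pow2, gk_sq, (proj2 (root_rho_spec d 0 Hd)) by trivial.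
    rewrite cos_0. field. }
  assert (EN : gap d 0 0 = root_g d 0 ^ 2)
    by (rewrite Eg; unfold gap; rewrite cos_0; field).
  rewrite Er, Eh, EN, Ek', sin_0, cos_0.
  repeat split; field; lra.
Qed.

Lemma orbit_u_zero (d th ph : R) :
  - 3 / 2 < d < 3 / 2 -> orbit_u d th ph = 0 <-> sin th = 0.
Proof.
  intros Hd. destruct (root_g_spec d ph Hd) as [Hg _].
  assert (H3 : 0 < sqrt 3) by (apply sqrt_lt_R0; lra).
  unfold orbit_u. split; intros E.
  - apply (Rmult_eq_reg_r (root_g d ph / sqrt 3)).
    + rewrite Rmult_0_l, <- E. field. lra.
    + apply Rgt_not_eq, Rdiv_lt_0_compat; trivial.
  - rewrite E. field. lra.
Qed.

Lemma orbit_v_pos (d th ph : R) : - 3 / 2 < d < 3 / 2 -> 0 < orbit_v d th ph.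
Proof.
  intros Hd. destruct (root_k_spec d ph Hd) as [Hk _].
  destruct (root_h_spec th) as [Hh _].
  assert (H3 : 0 < sqrt 3) by (apply sqrt_lt_R0; lra).
  apply Rdiv_lt_0_compat; trivial. now apply Rmult_lt_0_compat.
Qed.

Lemma sin_zero_below_2PI (x : R) :
  0 <= x < 2 * PI -> sin x = 0 -> x = 0 \/ x = PI.
Proof.
  intros Hx E. destruct (Rtotal_order x PI) as [H|[H|H]]; auto.
  - destruct (Req_dec x 0) as [|H0]; auto.
    assert (0 < sin x) by (apply sin_gt_0; lra). lra.
  - assert (sin x < 0) by (apply sin_lt_0; lra). lra.
Qed.

(** The zeros of [f] are the times at which the increasing angle passes a multiple
    of [PI], starting with time [0]; a half-open period that contains exactly two
    of them ends at the third one. *)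
Lemma two_zeros_angle (th clock f : R -> R) (T : R) :
  (forall a b, a < b -> th a < th b) -> th 0 = 0 ->
  (forall t, clock (th t) = t) -> (forall x, th (clock x) = x) ->
  (forall t, f t = 0 <-> sin (th t) = 0) ->
  0 < T -> f T = 0 -> (two_zeros_on f T <-> th T = 2 * PI).
Proof.
  intros Hinc H0 Cth thC Hz HT EfT. assert (Hpi := PI_RGT_0).
  assert (Hlt : forall t x, t < clock x <-> th t < x).
  { intros t x. split; intros H.
    - rewrite <- (thC x). now apply Hinc.
    - destruct (Rtotal_order t (clock x)) as [A|[A|A]]; trivial.
      + subst. rewrite thC in H. lra.
      + apply Hinc in A. rewrite thC in A. lra. }
  assert (Hinj : forall t x, th t = x -> t = clock x)
    by (intros t x <-; symmetry; apply Cth).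
  assert (C0 : clock 0 = 0) by (symmetry; now apply Hinj).
  assert (HthT : 0 < th T) by (rewrite <- H0; now apply Hinc).
  split.
  - intros (a & b & Hab & Hzero).
    assert (Hrange : forall t, 0 <= t < T -> 0 <= th t < th T).
    { intros t Ht. split; [|now apply Hinc].
      destruct (Req_dec t 0) as [->|]; [lra|]. left. rewrite <- H0. apply Hinc. lra. }
    destruct (Rtotal_order (th T) (2 * PI)) as [H|[H|H]]; trivial; exfalso.
    + destruct (sin_zero_below_2PI (th T)) as [E|E]; [lra|now apply Hz|lra|].
      assert (Honly : forall t, t = a \/ t = b -> t = 0).
      { intros t Ht. apply Hzero in Ht. destruct Ht as [Ht Eft].
        apply Hrange in Ht. apply Hz in Eft.
        destruct (sin_zero_below_2PI (th t)) as [E'|E']; trivial; [lra| |lra].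
        rewrite <- C0. now apply Hinj. }
      apply Hab. rewrite (Honly a), (Honly b); auto.
    + assert (Hin : forall x, 0 <= x < th T -> sin x = 0 ->
        clock x = a \/ clock x = b).
      { intros x Hx Ex. apply Hzero. split; [split|].
        - destruct (Req_dec x 0) as [->|]; [lra|]. left. apply Hlt. lra.
        - destruct (Rlt_or_le (clock x) T) as [A|A]; trivial.
          destruct (Req_dec (clock x) T) as [B|B].
          + rewrite <- B, thC in Hx. lra.
          + assert (A' : T < clock x) by lra. apply Hlt in A'. lra.
        - apply Hz. now rewrite thC. }
      assert (I1 := Hin 0 ltac:(lra) sin_0).
      assert (I2 := Hin PI ltac:(lra) sin_PI).
      assert (I3 := Hin (2 * PI) ltac:(lra) sin_2PI).
      assert (N1 : clock 0 < clock PI) by (apply Hlt; rewrite thC; lra).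
      assert (N2 : clock PI < clock (2 * PI)) by (apply Hlt; rewrite thC; lra).
      destruct I1, I2, I3; lra.
  - intros ET. exists 0, (clock PI).
    assert (N1 : 0 < clock PI) by (apply Hlt; rewrite H0; lra).
    split; [lra|]. intros t. split.
    + intros [Ht Eft]. apply Hz in Eft.
      destruct (sin_zero_below_2PI (th t)) as [E|E]; trivial.
      * split.
        -- destruct (Req_dec t 0) as [->|]; [lra|]. left. rewrite <- H0.
           apply Hinc. lra.
        -- rewrite <- ET. now apply Hinc.
      * left. rewrite <- C0. now apply Hinj.
      * right. now apply Hinj.
    + intros [->| ->].
      * split; [lra|]. apply Hz. rewrite H0. apply sin_0.
      * split; [split; [lra|]|].
        -- rewrite (Hinj T (2 * PI) ET). apply Hlt. rewrite thC. lra.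
        -- apply Hz. rewrite thC. apply sin_PI.
Qed.

Lemma follows_angles_incr (d : R) (th ph : R -> R) :
  - 3 / 2 < d < 3 / 2 -> follows_angles d th ph ->
  forall a b, a < b -> th a < th b.
Proof.
  intros Hd Ha a b Hab.
  apply (derive_pos_incr th
    (fun t => root_h (th t) * root_rho d (th t) / gap d (th t) (ph t))); trivial.
  { intros x. apply Ha. }
  intros x. apply Rdiv_lt_0_compat; [now apply h_rho_pos|now apply gap_pos].
Qed.

(** At time [T] the angle [ph] lies strictly between one and two turns, where
    [cos < 1]; so [l2] can only have come back to its initial value if it is
    constant. *)
Lemma admissible_amplitude_zero (d T : R) (th ph F1 F2 : R -> R) :
  - 3 / 2 < d < 3 / 2 -> F1 0 = 0 -> F2 0 = 0 ->
  (forall x, is_derive F1 x (weight1 d x)) ->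
  (forall x, is_derive F2 x (weight2 d x)) ->
  (forall t, F2 (ph t) = F1 (th t)) ->
  th 0 = 0 -> ph 0 = 0 -> th T = 2 * PI ->
  orbit_v d (th T) (ph T) = orbit_v d (th 0) (ph 0) -> d = 0.
Proof.
  intros Hd F10 F20 HF1 HF2 HF th0 ph0 thT EvT.
  destruct (periods_interlace d F1 F2 Hd F10 F20 HF1 HF2) as [A B].
  assert (EF : F2 (ph T) = F1 (2 * PI)) by now rewrite HF, thT.
  rewrite <- EF in A, B.
  assert (Hw : forall x, 0 < weight2 d x).
  { intros x. rewrite weight2_weightK by exact Hd.
    destruct (root_l_spec d x Hd) as [Hl _]. apply Rinv_0_lt_compat in Hl.
    generalize (weightK_pos d x Hd). nra. }
  assert (Hback : forall x y, F2 x < F2 y -> x < y).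
  { intros x y H. destruct (Rtotal_order x y) as [E|[E|E]]; trivial.
    - subst. lra.
    - apply (derive_pos_incr F2 (weight2 d)) in E; trivial. lra. }
  apply Hback in A. apply Hback in B.
  assert (Hcos : cos (ph T) < 1).
  { replace (ph T) with (2 * (ph T / 2)) by field. rewrite cos_2a_sin.
    assert (sin (ph T / 2) < 0) by (apply sin_lt_0; lra). nra. }
  destruct (root_k_spec d (ph T) Hd) as [Hk Ek].
  destruct (root_k_spec d 0 Hd) as [Hk0 Ek0].
  destruct (root_h_spec 0) as [Hh _].
  assert (H3 : 0 < sqrt 3) by (apply sqrt_lt_R0; lra).
  assert (Eh : root_h (2 * PI) = root_h 0)
    by (unfold root_h; now rewrite cos_2PI, cos_0).
  unfold orbit_v in EvT. rewrite th0, ph0, thT, Eh in EvT.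
  assert (E : root_k d (ph T) = root_k d 0).
  { apply (Rmult_eq_reg_l (root_h 0 / sqrt 3)).
    - unfold Rdiv in *. lra.
    - apply Rgt_not_eq. now apply Rdiv_lt_0_compat. }
  rewrite E, Ek0, cos_0 in Ek. nra.
Qed.

(** For [d = 0] the motion of [th] is autonomous and the speed depends on
    [cos^2 th], so half a turn always takes the same time.  Half a turn changes the
    sign of [u], hence the least period is a full turn. *)
Lemma hyperbolic_orbit_admissible (th ph clock : R -> R) :
  follows_angles 0 th ph -> th 0 = 0 ->
  (forall t, clock (th t) = t) -> (forall x, th (clock x) = x) ->
  (forall x, is_derive clock x
     (gap 0 x (ph (clock x)) / (root_h x * root_rho 0 x))) ->
  admissible (fun t => orbit_u 0 (th t) (ph t))
    (fun t => orbit_v 0 (th t) (ph t) / 2).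
Proof.
  intros Ha th0 Cth thC HC. assert (H0 : - 3 / 2 < 0 < 3 / 2) by lra.
  assert (Hpi := PI_RGT_0).
  assert (Hinc := follows_angles_incr 0 th ph H0 Ha).
  assert (C0 : clock 0 = 0) by (transitivity (clock (th 0)); [now rewrite th0|apply Cth]).
  assert (Hshift : forall x, clock (x + PI) = clock x + clock PI).
  { intros x.
    assert (E : clock (x + PI) - clock x = clock (0 + PI) - clock 0).
    { apply (derive_zero_const (fun x => clock (x + PI) - clock x)). clear x. intros x.
      assert (A := HC x). assert (B := HC (x + PI)). compute_derive.
      unfold gap, root_h, root_rho. rewrite neg_cos.
      replace ((- cos x) ^ 2) with (cos x ^ 2) by ring.
      rewrite !Rmult_0_l. ring. }
    rewrite Rplus_0_l, C0 in E. lra. }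
  assert (Hth : forall t, th (t + clock PI) = th t + PI).
  { intros t. rewrite <- (thC (th t + PI)), Hshift, Cth. reflexivity. }
  assert (HP : 0 < clock PI).
  { destruct (Rlt_or_le 0 (clock PI)) as [H|H]; trivial.
    assert (H1 : th (clock PI) <= th 0)
      by (destruct H as [H| ->]; [left; now apply Hinc|lra]).
    rewrite thC, th0 in H1. lra. }
  assert (Hroot : forall a b, root_g 0 a = root_g 0 b /\ root_k 0 a = root_k 0 b)
    by (intros; unfold root_g, root_k; now rewrite !Rmult_0_l).
  assert (Hz : forall t, orbit_u 0 (th t) (ph t) = 0 <-> sin (th t) = 0)
    by (intro t; now apply orbit_u_zero).
  set (T := clock PI + clock PI).
  assert (HthT : forall t, th (t + T) = th t + 2 * PI).
  { intros t. unfold T. rewrite <- Rplus_assoc, !Hth. ring. }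
  assert (ET : th T = 2 * PI).
  { rewrite <- (Rplus_0_l T), HthT, th0. ring. }
  split; [exists T; split; [split|]|].
  - split; [unfold T; lra|]. intros t. unfold orbit_u, orbit_v, root_h.
    rewrite HthT. destruct (Hroot (ph (t + T)) (ph t)) as [-> ->].
    rewrite sin_plus, cos_plus, sin_2PI, cos_2PI.
    replace (cos (th t) * 1 - sin (th t) * 0) with (cos (th t)) by ring.
    replace (sin (th t) * 1 + cos (th t) * 0) with (sin (th t)) by ring.
    now split.
  (* A smaller period would be the time of half a turn; compare [u] at the quarter
     turn and half a turn later. *)
  - intros S [HS HP']. destruct (Rle_or_lt T S) as [H|H]; trivial. exfalso.
    assert (ES : sin (th S) = 0).
    { apply Hz. rewrite <- (Rplus_0_l S). rewrite (proj1 (HP' 0)). apply Hz.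
      rewrite th0. apply sin_0. }
    apply Hinc in H. apply Hinc in HS. rewrite th0 in HS.
    destruct (sin_zero_below_2PI (th S)) as [E|E]; trivial; [lra|lra|].
    assert (ES' : S = clock PI) by (rewrite <- E; symmetry; apply Cth).
    destruct (HP' (clock (PI / 2))) as [E1 _]. subst S.
    unfold orbit_u in E1. rewrite Hth, thC, neg_sin, sin_PI2 in E1.
    destruct (Hroot (ph (clock (PI / 2) + clock PI)) (ph (clock (PI / 2)))) as [R1 _].
    rewrite R1 in E1.
    destruct (root_g_spec 0 (ph (clock (PI / 2))) H0) as [Hg _].
    assert (H3 : 0 < / sqrt 3) by (apply Rinv_0_lt_compat, sqrt_lt_R0; lra).
    unfold Rdiv in E1. nra.
  - apply (two_zeros_angle th clock); trivial; [unfold T; lra|].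
    apply Hz. rewrite ET. apply sin_2PI.
  - intros t. generalize (orbit_v_pos 0 (th t) (ph t) H0). lra.
Qed.

Lemma admissible_initial_value (q : R) (psi1 psi2 : R -> R) :
  0 < q -> is_solution q psi1 psi2 -> admissible psi1 psi2 -> q ^ 2 = 3 / 8.
Proof.
  intros Hq Hsol [(T & [[HT Hper] _] & Hzeros) Hpos].
  destruct (solution_flow q psi1 psi2 Hsol) as [Hf Hi].
  destruct (Hper 0) as [P1 P2]. rewrite Rplus_0_l in P1, P2.
  destruct (Rle_or_lt (3 / 4) (q ^ 2)) as [Hq2|Hq2].
  { exfalso. refine (positive_flow_not_periodic q T _ _ _ _ Hq Hq2 Hf Hi _ HT _).
    - intros t. specialize (Hpos t). lra.
    - simpl. now rewrite P2. }
  set (d := 3 / 2 - 4 * q ^ 2).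
  assert (Hd : - 3 / 2 < d < 3 / 2) by (unfold d; nra).
  destruct (angles_exist d Hd) as (th & ph & clock & F1 & F2 & Ha & th0 & ph0 &
    Cth & thC & _ & F10 & F20 & HF1 & HF2 & HF).
  destruct (orbit_flow q Hq Hq2 th ph Ha th0 ph0) as [Hg Hj].
  fold d in Hg, Hj.
  assert (Heq : forall t, psi1 t = orbit_u d (th t) (ph t) /\
                          2 * psi2 t = orbit_v d (th t) (ph t)).
  { destruct Hi as (I1 & I2 & I3 & I4). destruct Hj as (J1 & J2 & J3 & J4).
    apply (flow_unique _ _ _ _ _ _ _ _ Hf Hg); congruence. }
  assert (E1 : psi1 0 = 0) by apply Hi.
  assert (ET : th T = 2 * PI).
  { apply (two_zeros_angle th clock psi1); trivial.
    - now apply (follows_angles_incr d th ph).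
    - intros t. rewrite (proj1 (Heq t)). now apply orbit_u_zero.
    - congruence. }
  assert (E : d = 0).
  { apply (admissible_amplitude_zero d T th ph F1 F2); trivial.
    rewrite <- (proj2 (Heq T)), <- (proj2 (Heq 0)). congruence. }
  unfold d in E. lra.
Qed.

Theorem theorem3p1 :
  exists (p : R) (phi1 phi2 : R -> R),
    (0 < p <= 1 /\ is_solution p phi1 phi2 /\ admissible phi1 phi2) /\
    (forall (q : R) (psi1 psi2 : R -> R),
       0 < q <= 1 -> is_solution q psi1 psi2 -> admissible psi1 psi2 ->
       q = p /\ forall t : R, psi1 t = phi1 t /\ psi2 t = phi2 t) /\
    p = sqrt (3 / 8).
Proof.
  set (p := sqrt (3 / 8)).
  destruct (sqrt_spec (3 / 8) ltac:(lra)) as [Hp Ep]. fold p in Hp, Ep.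
  assert (Hp1 : p <= 1) by nra.
  destruct (angles_exist 0 ltac:(lra)) as (th & ph & clock & F1 & F2 & Ha & th0 & ph0 &
    Cth & thC & HC & _).
  assert (E0 : 3 / 2 - 4 * p ^ 2 = 0) by lra.
  assert (Hflow := orbit_flow p Hp ltac:(lra) th ph). cbv zeta in Hflow.
  rewrite E0 in Hflow. destruct (Hflow Ha th0 ph0) as [Hf Hi].
  assert (Hsol := flow_solution p _ _ _ _ Hf Hi).
  exists p, (fun t => orbit_u 0 (th t) (ph t)), (fun t => orbit_v 0 (th t) (ph t) / 2).
  split; [split; [lra|split; [exact Hsol|]]|split; [|reflexivity]].
  - now apply (hyperbolic_orbit_admissible th ph clock).
  - intros q psi1 psi2 Hq Hpsi Hadm.
    assert (Eq : q = p).
    { assert (Eq2 := admissible_initial_value q psi1 psi2 (proj1 Hq) Hpsi Hadm).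
      apply Rsqr_inj; [lra|lra|]. now rewrite !Rsqr_pow2, Eq2, Ep. }
    split; [exact Eq|]. subst q.
    destruct (solution_flow p psi1 psi2 Hpsi) as [Hg Hj].
    destruct Hi as (I1 & I2 & I3 & I4). destruct Hj as (J1 & J2 & J3 & J4).
    intros t.
    destruct (flow_unique _ _ _ _ _ _ _ _ Hg Hf) with (t := t) as [U V];
      try congruence.
    split; [exact U|lra].
Qed.
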